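(* Let $M=U\subset\mathbb R^2$ be open, let $(U,F)$ be a conic pseudo-Finsler surface with $F$ defined on the conic sub-bundle $\mathcal A$ and $F$ projectively flat. Let $\phi:\mathcal A\to\mathbb R$ be a smooth function positively homogeneous of degree $0$ in $y$ with $\sigma+\varepsilon-(\phi_{;2})^2\neq0$ on $\mathcal A$, where $\sigma=\phi_{;2;2}+\varepsilon\mathcal I\phi_{;2}+2(\phi_{;2})^2$, and let $\overline F=e^{\phi}F$. Then $\overline F$ is projectively flat if and only if $\phi_{;2}\phi_{,1}+\phi_{,1;2}-2\phi_{,2}=0$.
   Context: $(x^1,x^2)$ are the standard coordinates on $U\subset\mathbb R^2$ and $(x^i,y^i)$ the induced coordinates on $TU$; repeated indices are summed over $\{1,2\}$. Write $\partial_i=\partial/\partial x^i$, $\dot\partial_i=\partial/\partial y^i$. A function is $h(r)$ if it is positively homogeneous of degree $r$ in $y$. A conic sub-bundle is a non-empty open subset $\mathcal A\subset TU\setminus 0$ projecting onto $U$ and closed under multiplication by positive scalars. A conic pseudo-Finsler metric is a smooth $h(1)$ function $F:\mathcal A\to\mathbb R$ such that $g_{ij}=\tfrac12\dot\partial_i\dot\partial_jF^2$ is non-degenerate at each point of $\mathcal A$; $(g^{ij})$ is the inverse matrix. A conic pseudo-Finsler surface is equipped with its modified Berwald frame: $F$ is nowhere zero on $\mathcal A$, $\ell_i=\dot\partial_iF$, $\ell^i=y^i/F$, $\varepsilon\in\{1,-1\}$ (the signature) is the sign of $\det(g_{ij})$, $m_1=-\sqrt{\varepsilon\det(g_{ij})}\,\ell^2$,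 $m_2=\sqrt{\varepsilon\det(g_{ij})}\,\ell^1$, $m^i=g^{ij}m_j$; thus $g_{ij}=\ell_i\ell_j+\varepsilon m_im_j$, $\ell^im_i=0$, $m^im_i=\varepsilon$. The main scalar $\mathcal I$ is defined by $F\,C_{ijk}=\mathcal I\,m_im_jm_k$, where $C_{ijk}=\tfrac12\dot\partial_kg_{ij}$. The geodesic spray coefficients of $F$ are $G^i=\tfrac14g^{ij}(y^k\dot\partial_j\partial_kF^2-\partial_jF^2)$; $G^j_i=\dot\partial_iG^j$ and $\delta_i=\partial_i-G^j_i\dot\partial_j$. The condition $\sigma+\varepsilon-(\phi_{;2})^2\ne0$ guarantees that $\overline F$ is a conic pseudo-Finsler metric. A conic pseudo-Finsler metric $F$ on $U$ is projectively flat if $y^j\partial_j\dot\partial_iF=\partial_iF$ for all $i$ (equivalently $\dot\partial_i(y^j\partial_jF)=2\partial_iF$; equivalently $G^i=\mathcal Py^i$ with $\mathcal P=y^k\partial_kF/(2F)$). For a smooth function $f$ on $\mathcal A$: $f_{;2}:=\varepsilon F(\dot\partial_if)m^i$, $f_{,1}:=(\delta_if)\ell^i$, $f_{,2}:=\varepsilon(\delta_if)m^i$, and iterated symbols are read left to right, e.g. $f_{;2;2}=(f_{;2})_{;2}$, $f_{,1;2}=(f_{,1})_{;2}$. *)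

(* Defs.v *)
From HB Require Import structures.
From mathcomp Require Import all_boot all_order all_algebra.
From mathcomp Require Import all_classical all_reals all_analysis.

Set Implicit Arguments.
Unset Strict Implicit.
Unset Printing Implicit Defensive.

Import Order.TTheory GRing.Theory Num.Theory.
Import numFieldNormedType.Exports.

Local Open Scope classical_set_scope.
Local Open Scope ring_scope.

(* T(R^2) = R^2 x R^2; a point p has base coordinates x^i = p.1 0 i and fibre
   coordinates y^i = p.2 0 i.  The indices 1, 2 are written 0, 1 : 'I_2.
   Functions on a conic sub-bundle A are total functions on T(R^2) that are only
   ever constrained and evaluated on A; A being open, derivatives at points of A
   depend only on the values on A. *)
Notation TR2 R := ('rV[R]_2 * 'rV[R]_2)%type.

Definition dx (R : realType) (i : 'I_2) (f : TR2 R -> R) : TR2 R -> R :=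
  'D_((delta_mx 0 i, 0) : TR2 R) f.

Definition dy (R : realType) (i : 'I_2) (f : TR2 R -> R) : TR2 R -> R :=
  'D_((0, delta_mx 0 i) : TR2 R) f.

(* C^oo on an open set: the derivatives of all orders exist, that is, every
   iterated directional derivative (including f itself, for vs = [::]) is
   Frechet differentiable. *)
Definition smooth_on (R : realType) (A : set (TR2 R)) (f : TR2 R -> R) : Prop :=
  forall (vs : seq (TR2 R)) (p : TR2 R), A p ->
    differentiable (foldr (fun v h => 'D_v h) f vs) p.

Definition homogeneous (R : realType) (A : set (TR2 R)) (r : R)
    (f : TR2 R -> R) : Prop :=
  forall p t, A p -> 0 < t -> f (p.1, t *: p.2) = t `^ r * f p.

Definition conic_subbundle (R : realType) (U : set 'rV[R]_2)
    (A : set (TR2 R)) : Prop :=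
  [/\ open A, A !=set0,
      forall p, A p -> p.2 != 0,
      fst @` A = U &
      forall p t, A p -> 0 < t -> A (p.1, t *: p.2)].

Definition metric (R : realType) (F : TR2 R -> R) (p : TR2 R) : 'M[R]_2 :=
  \matrix_(i, j) (2^-1 * dy i (dy j (fun q => F q ^+ 2)) p).

Definition conic_pseudo_finsler (R : realType) (A : set (TR2 R))
    (F : TR2 R -> R) : Prop :=
  [/\ smooth_on A F, homogeneous A 1 F &
      forall p, A p -> metric F p \in unitmx].

(* The modified Berwald frame: ell_dn, m_dn are the covectors \ell_i, m_i and
   ell_up, m_up the vectors \ell^i, m^i. *)

(* The sign is taken pointwise, so that it is only locally constant when A is
   disconnected. *)
Definition signature (R : realType) (F : TR2 R -> R) (p : TR2 R) : R :=
  Num.sg (\det (metric F p)).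

Definition ell_dn (R : realType) (F : TR2 R -> R) (i : 'I_2) : TR2 R -> R :=
  dy i F.

Definition ell_up (R : realType) (F : TR2 R -> R) (i : 'I_2) (p : TR2 R) : R :=
  p.2 0 i / F p.

Definition m_dn (R : realType) (F : TR2 R -> R) (i : 'I_2) (p : TR2 R) : R :=
  let s := Num.sqrt (signature F p * \det (metric F p)) in
  if i == 0 then - s * ell_up F 1 p else s * ell_up F 0 p.

Definition m_up (R : realType) (F : TR2 R -> R) (i : 'I_2) (p : TR2 R) : R :=
  \sum_(j < 2) invmx (metric F p) i j * m_dn F j p.

Definition cartan (R : realType) (F : TR2 R -> R) (i j k : 'I_2)
    (p : TR2 R) : R :=
  2^-1 * dy k (fun q => metric F q i j) p.

Definition is_main_scalar (R : realType) (A : set (TR2 R)) (F : TR2 R -> R)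
    (I : TR2 R -> R) : Prop :=
  forall p, A p -> forall i j k : 'I_2,
    F p * cartan F i j k p = I p * m_dn F i p * m_dn F j p * m_dn F k p.

Definition spray (R : realType) (F : TR2 R -> R) (i : 'I_2) (p : TR2 R) : R :=
  4^-1 * \sum_(j < 2) invmx (metric F p) i j *
    (\sum_(k < 2) p.2 0 k * dy j (dx k (fun q => F q ^+ 2)) p
     - dx j (fun q => F q ^+ 2) p).

(* The operator \delta_i, with G^j_i = dy i (spray F j). *)
Definition delta (R : realType) (F : TR2 R -> R) (i : 'I_2) (f : TR2 R -> R)
    (p : TR2 R) : R :=
  dx i f p - \sum_(j < 2) dy i (spray F j) p * dy j f p.

(* f_{;2} *)
Definition vert2 (R : realType) (F f : TR2 R -> R) (p : TR2 R) : R :=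
  signature F p * F p * \sum_(i < 2) dy i f p * m_up F i p.

(* f_{,1} *)
Definition hor1 (R : realType) (F f : TR2 R -> R) (p : TR2 R) : R :=
  \sum_(i < 2) delta F i f p * ell_up F i p.

(* f_{,2} *)
Definition hor2 (R : realType) (F f : TR2 R -> R) (p : TR2 R) : R :=
  signature F p * \sum_(i < 2) delta F i f p * m_up F i p.

Definition projectively_flat (R : realType) (A : set (TR2 R))
    (F : TR2 R -> R) : Prop :=
  forall p, A p -> forall i : 'I_2,
    \sum_(j < 2) p.2 0 j * dx j (dy i F) p = dx i F p.

Definition sigma (R : realType) (F I phi : TR2 R -> R) (p : TR2 R) : R :=
  vert2 F (vert2 F phi) p + signature F p * I p * vert2 F phi p
  + 2 * vert2 F phi p ^+ 2.

(* Main.v *)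
(* Write D = y^j d/dx^j.  Subtracting the flatness of F, flatness of e^phi F says
   that the covector
     W_i = D(phi) (F phi_i + l_i) + F D(phi_i) + phi_i D(F) - F d_i phi
   vanishes, where phi_i and l_i are the fibre derivatives of phi and F.  Euler's
   relations for F and phi give y^i W_i = 0 identically, so only m^i W_i matters,
   y and m being linearly independent.  As F is flat, G^i = P y^i with
   P = D(F) / (2 F), whence phi_{,1} = D(phi) / F and
   phi_{,2} = epsilon m^i (d_i phi - P phi_i); with l_i m^i = 0 and the symmetry of
   second derivatives, F times the left-hand side of the stated condition is
   epsilon m^i W_i. *)

Require Import Defs.
From HB Require Import structures.
From mathcomp Require Import all_boot all_order all_algebra.
From mathcomp Require Import all_classical all_reals all_analysis.
From mathcomp Require Import ring.
Import Order.TTheory GRing.Theory Num.Theory.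
Import numFieldNormedType.Exports.
Local Open Scope classical_set_scope.
Local Open Scope ring_scope.

Set Implicit Arguments.
Unset Strict Implicit.

(** * Symmetry of mixed second derivatives *)

(** The two difference quotients are the same function, so one-variable results such as the mean
    value theorem apply along a line. *)
Lemma is_derive_line (R : realType) (V : normedModType R) (f : V -> R)
    (p v : V) (t l : R) :
  is_derive (p + t *: v) v f l <-> is_derive t 1 (fun s => f (p + s *: v)) l.
Proof.
have E : (fun h : R => h^-1 *: (((fun s => f (p + s *: v)) \o shift t) (h *: 1)
            - f (p + t *: v))) =
    (fun h => h^-1 *: ((f \o shift (p + t *: v)) (h *: v) - f (p + t *: v))).
  apply/funext => h /=; congr (_ *: (f _ - _)).
  by rewrite scalerDl [h *: 1]mulr1 addrCA.
split=> -[].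
  by move=> dfv <-; split; rewrite /derivable /derive E.
by rewrite /derivable /derive E => dfv <-; split.
Qed.

(** The mean value theorem is used twice: along [v] for the difference of [f] over two parallel
    sides, then along [w] for [fv]. *)
Lemma second_difference_mvt (R : realType) (V : normedModType R)
    (f fv fvw : V -> R) (p v w : V) (h : R) : 0 < h ->
  (forall s t, s \in `[0, h] -> t \in `[0, h] ->
     is_derive (p + t *: w + s *: v) v f (fv (p + t *: w + s *: v)) /\
     is_derive (p + s *: v + t *: w) w fv (fvw (p + s *: v + t *: w))) ->
  exists s t, [/\ s \in `[0, h], t \in `[0, h] &
    f (p + h *: w + h *: v) - f (p + h *: v) - (f (p + h *: w) - f p) =
    fvw (p + s *: v + t *: w) * h * h].
Proof.
move=> h0 df.
have i0 : 0 \in `[0, h] by rewrite in_itv /= lexx ltW.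
have ih : h \in `[0, h] by rewrite in_itv /= lexx ltW.
pose g s := f (p + h *: w + s *: v) - f (p + s *: v).
pose dg s := fv (p + h *: w + s *: v) - fv (p + s *: v).
have d1 s : s \in `[0, h] -> is_derive s 1 g (dg s).
  move=> si; have [dh _] := df s h si ih; have [d0 _] := df s 0 si i0.
  rewrite scale0r addr0 in d0.
  by move/is_derive_line: dh => dh; move/is_derive_line: d0 => d0; exact: is_deriveB.
have cg : {within [set` `[0, h]%R], continuous g}.
  apply: derivable_within_continuous => s sI.
  exact: (@ex_derive _ _ _ _ _ _ _ (d1 s sI)).
have d1o s : s \in `]0, h[ -> is_derive s 1 g (dg s).
  by move=> sI; apply: d1; exact: (@subset_itv_oo_cc _ _ 0 h).
have [s sI Es] := @MVT R g dg 0 h h0 d1o cg.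
have si : s \in `[0, h] by exact: (@subset_itv_oo_cc _ _ 0 h).
pose k t := fv (p + s *: v + t *: w).
pose dk t := fvw (p + s *: v + t *: w).
have d2 t : t \in `[0, h] -> is_derive t 1 k (dk t).
  by move=> ti; have [_ /is_derive_line] := df s t si ti.
have ck : {within [set` `[0, h]%R], continuous k}.
  apply: derivable_within_continuous => t tI.
  exact: (@ex_derive _ _ _ _ _ _ _ (d2 t tI)).
have d2o t : t \in `]0, h[ -> is_derive t 1 k (dk t).
  by move=> tI; apply: d2; exact: (@subset_itv_oo_cc _ _ 0 h).
have [t tI Et] := @MVT R k dk 0 h h0 d2o ck.
exists s, t; split => //; first exact: (@subset_itv_oo_cc _ _ 0 h).
move: Es Et; rewrite /g /dg /k -/(dk t) !scale0r !addr0 !subr0 => -> <-.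
by rewrite [p + s *: v + _]addrAC.
Qed.

(* Both mixed derivatives are the limit of the second difference of [f] over the
   parallelogram spanned by [h *: v] and [h *: w], divided by h^2. *)
Lemma derive_comm (R : realType) (V : normedModType R) (A : set V)
    (f fv fw fvw fwv : V -> R) (v w p : V) : open A -> A p ->
  (forall q, A q -> is_derive q v f (fv q)) ->
  (forall q, A q -> is_derive q w f (fw q)) ->
  (forall q, A q -> is_derive q w fv (fvw q)) ->
  (forall q, A q -> is_derive q v fw (fwv q)) ->
  {for p, continuous fvw} -> {for p, continuous fwv} ->
  fvw p = fwv p.
Proof.
move=> oA Ap dv dw dvw dwv cvw cwv.
apply/eqP; rewrite -subr_eq0 -normr_le0; apply/ler_addgt0Pl => e e0.
have e20 : 0 < e / 2 by rewrite divr_gt0.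
(* On this ball both mixed derivatives stay within [e / 2] of their values at [p]. *)
have /nbhs_ballP[r /= r0 rP] : \forall q \near p,
    [/\ A q, `|fvw p - fvw q| < e / 2 & `|fwv p - fwv q| < e / 2].
  have n0 : \forall q \near p, A q by exact: open_nbhs_nbhs.
  have /(_ _ _ e20) n1 := @cvgr_dist_lt _ _ _ _ _ _ _ cvw.
  have /(_ _ _ e20) n2 := @cvgr_dist_lt _ _ _ _ _ _ _ cwv.
  by apply: filterS3 n0 n1 n2.
(* The summand 1 keeps [N] positive even for [v = w = 0]. With [h = r / (2 * N)] every point of the
   parallelogram lies within [h * N = r / 2] of [p]. *)
pose N := 1 + `|v| + `|w|.
have N0 : 0 < N by rewrite /N -addrA ltr_wpDr // addr_ge0.
pose h := r / (2 * N).
have h0 : 0 < h by rewrite divr_gt0 // mulr_gt0.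
have inr s t : s \in `[0, h] -> t \in `[0, h] -> ball p r (p + s *: v + t *: w).
  rewrite !in_itv /= => /andP[s0 sh] /andP[t0 th].
  rewrite -ball_normE /ball_ /= -addrA opprD addNKr normrN.
  rewrite (le_lt_trans (ler_normD _ _)) // !normrZ !ger0_norm //.
  apply: (@le_lt_trans _ _ (h * N)).
    rewrite /N !mulrDr mulr1 -addrA ler_wpDl ?(ltW h0) //.
    by rewrite lerD // ler_wpM2r.
  by rewrite /h invfM mulrA mulfVK ?gt_eqF // ltr_pdivrMr // ltr_pMr // ltr1n.
have inA s t (si : s \in `[0, h]) (ti : t \in `[0, h]) := rP _ (inr s t si ti).
have [s [t [si ti E1]]] : exists s t, [/\ s \in `[0, h], t \in `[0, h] &
    f (p + h *: w + h *: v) - f (p + h *: v) - (f (p + h *: w) - f p) =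
    fvw (p + s *: v + t *: w) * h * h].
  apply: (second_difference_mvt h0) => s t si ti.
  have [Aq _ _] := inA s t si ti.
  by split; [rewrite addrAC; exact: dv | exact: dvw].
have [t' [s' [ti' si' E2]]] : exists t s, [/\ t \in `[0, h], s \in `[0, h] &
    f (p + h *: v + h *: w) - f (p + h *: w) - (f (p + h *: v) - f p) =
    fwv (p + t *: w + s *: v) * h * h].
  apply: (second_difference_mvt h0) => t' s' ti' si'.
  have [Aq _ _] := inA s' t' si' ti'.
  by split; [exact: dw | rewrite addrAC; exact: dwv].
have [_ a1 _] := inA s t si ti.
have [_ _ a2] := inA s' t' si' ti'.
(* The second difference is symmetric in [v] and [w], so both values equal it divided by h^2. *)
have E : fvw (p + s *: v + t *: w) = fwv (p + s' *: v + t' *: w).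
  have hn0 : h != 0 by rewrite gt_eqF.
  apply: (mulIf hn0); apply: (mulIf hn0).
  by rewrite -E1 [p + s' *: v + _]addrAC -E2 [p + h *: w + _]addrAC; ring.
rewrite addr0 -(subrKA (fvw (p + s *: v + t *: w))) (le_trans (ler_normD _ _)) //.
by rewrite {2}E [X in _ + X]distrC (splitr e) lerD // ltW.
Qed.

Lemma smooth_derive_comm (R : realType) (A : set (TR2 R)) (f : TR2 R -> R)
    (v w p : TR2 R) : open A -> smooth_on A f -> A p ->
  'D_w ('D_v f) p = 'D_v ('D_w f) p.
Proof.
move=> oA sf Ap; 
apply: (@derive_comm R _ A f ('D_v f) ('D_w f)
  ('D_w ('D_v f)) ('D_v ('D_w f)) v w p oA Ap).
- by move=> q Aq; apply/derivableP/diff_derivable; exact: (sf [::]).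
- by move=> q Aq; apply/derivableP/diff_derivable; exact: (sf [::]).
- by move=> q Aq; apply/derivableP/diff_derivable; exact: (sf [:: v]).
- by move=> q Aq; apply/derivableP/diff_derivable; exact: (sf [:: w]).
- exact: differentiable_continuous (sf [:: w; v] _ Ap).
- exact: differentiable_continuous (sf [:: v; w] _ Ap).
Qed.

(** * Rules for directional and partial derivatives *)

Lemma is_derive_mul (R : realType) (V : normedModType R) (f g : V -> R)
    (p v : V) (a b : R) : is_derive p v f a -> is_derive p v g b ->
  is_derive p v (fun q => f q * g q) (a * g p + f p * b).
Proof.
move=> fa gb; have := is_deriveM fa gb.
by rewrite addrC [g p *: a]mulrC.
Qed.

Lemma is_derive_inv (R : realType) (V : normedModType R) (f : V -> R)
    (p v : V) (a : R) : f p != 0 -> is_derive p v f a ->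
  is_derive p v (fun q => (f q)^-1) (- a / f p ^+ 2).
Proof.
move=> fp [df <-]; split; first exact: derivableV.
by rewrite deriveV // /GRing.scale /= mulNr -mulrN mulrC mulNr.
Qed.

Lemma is_derive_expR_comp (R : realType) (V : normedModType R) (f : V -> R)
    (p v : V) (a : R) : is_derive p v f a ->
  is_derive p v (fun q => expR (f q)) (expR (f p) * a).
Proof.
move=> fa.
have /is_derive_line {}fa : is_derive (p + 0 *: v) v f a.
  by rewrite scale0r addr0.
have := @is_derive_line R V (fun q => expR (f q)) p v 0 (expR (f p) * a).
rewrite scale0r addr0 => -[_]; apply; rewrite -{2}[p]addr0 -(scale0r v).
exact: (@is_derive1_comp R expR (fun s => f (p + s *: v)) 0).
Qed.

(** Derivatives are local and [A] is open; this is how identities known only on [A] get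
    differentiated. *)
Lemma is_derive_on (R : realType) (V : normedModType R) (A : set V)
    (f g : V -> R) (p v : V) (a : R) : open A -> A p ->
  (forall q, A q -> f q = g q) -> is_derive p v g a -> is_derive p v f a.
Proof.
move=> oA Ap fg; apply: near_eq_is_derive.
have : \forall q \near p, A q by exact: open_nbhs_nbhs.
by apply: filterS => q Aq; rewrite fg.
Qed.

(** The function is linear, so its difference quotient is constant for [h != 0]. *)
Lemma is_derive_fibre (R : realType) (p v : TR2 R) (j : 'I_2) :
  is_derive p v (fun q : TR2 R => q.2 0 j) (v.2 0 j).
Proof.
have E : (fun h : R => h^-1 *: (((fun q : TR2 R => q.2 0 j) \o shift p) (h *: v)
            - p.2 0 j)) @ 0^' --> v.2 0 j.
  apply: cvg_near_cst; near=> h.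
  have h0 : h != 0 by near: h; exact: nbhs_dnbhs_neq.
  by rewrite /= !mxE addrK [_ *: _]mulKf.
split; first by apply/cvg_ex; exists (v.2 0 j).
exact: cvg_lim.
Unshelve. all: by end_near. Qed.

(** [foldr] applies the last direction of the list first, hence [rcons]. *)
Lemma smooth_derive (R : realType) (A : set (TR2 R)) (f : TR2 R -> R)
    (v : TR2 R) : smooth_on A f -> smooth_on A ('D_v f).
Proof. by move=> sf vs p Ap; have := sf (rcons vs v) p Ap; rewrite foldr_rcons. Qed.

Lemma smooth_is_derive (R : realType) (A : set (TR2 R)) (f : TR2 R -> R)
    (p v : TR2 R) : smooth_on A f -> A p -> is_derive p v f ('D_v f p).
Proof. by move=> sf Ap; apply/derivableP/diff_derivable; exact: (sf [::]). Qed.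

(* Locked, so that unification never compares two partial derivatives by
   unfolding them to limits. *)
HB.lock Definition pdx (R : realType) (i : 'I_2) (f : TR2 R -> R) := dx i f.
HB.lock Definition pdy (R : realType) (i : 'I_2) (f : TR2 R -> R) := dy i f.

Lemma pdxE (R : realType) (i : 'I_2) (f : TR2 R -> R) : pdx i f = dx i f.
Proof. by rewrite unlock. Qed.

Lemma pdyE (R : realType) (i : 'I_2) (f : TR2 R -> R) : pdy i f = dy i f.
Proof. by rewrite unlock. Qed.

Lemma smooth_pdx (R : realType) (A : set (TR2 R)) (f : TR2 R -> R) (i : 'I_2) :
  smooth_on A f -> smooth_on A (pdx i f).
Proof. by rewrite pdxE; exact: smooth_derive. Qed.

Lemma smooth_pdy (R : realType) (A : set (TR2 R)) (f : TR2 R -> R) (i : 'I_2) :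
  smooth_on A f -> smooth_on A (pdy i f).
Proof. by rewrite pdyE; exact: smooth_derive. Qed.

Lemma pdy_pdxC (R : realType) (A : set (TR2 R)) (f : TR2 R -> R) (i j : 'I_2)
    (p : TR2 R) : open A -> smooth_on A f -> A p ->
  pdy i (pdx j f) p = pdx j (pdy i f) p.
Proof. by rewrite !pdxE !pdyE; exact: smooth_derive_comm. Qed.

Lemma pdy_pdyC (R : realType) (A : set (TR2 R)) (f : TR2 R -> R) (i j : 'I_2)
    (p : TR2 R) : open A -> smooth_on A f -> A p ->
  pdy i (pdy j f) p = pdy j (pdy i f) p.
Proof. by rewrite !pdyE; exact: smooth_derive_comm. Qed.

Lemma is_derive_pdx (R : realType) (A : set (TR2 R)) (f : TR2 R -> R)
    (p : TR2 R) (i : 'I_2) : smooth_on A f -> A p ->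
  is_derive p ((delta_mx 0 i, 0) : TR2 R) f (pdx i f p).
Proof. by move=> sf Ap; rewrite pdxE; exact: smooth_is_derive sf Ap. Qed.

Lemma is_derive_pdy (R : realType) (A : set (TR2 R)) (f : TR2 R -> R)
    (p : TR2 R) (i : 'I_2) : smooth_on A f -> A p ->
  is_derive p ((0, delta_mx 0 i) : TR2 R) f (pdy i f p).
Proof. by move=> sf Ap; rewrite pdyE; exact: smooth_is_derive sf Ap. Qed.

Lemma pdx_on (R : realType) (A : set (TR2 R)) (f g : TR2 R -> R) (i : 'I_2)
    (p : TR2 R) (a : R) : open A -> A p -> (forall q, A q -> f q = g q) ->
  is_derive p ((delta_mx 0 i, 0) : TR2 R) g a -> pdx i f p = a.
Proof.
by move=> oA Ap fg ga; rewrite pdxE; have [] := is_derive_on oA Ap fg ga.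
Qed.

Lemma pdy_on (R : realType) (A : set (TR2 R)) (f g : TR2 R -> R) (i : 'I_2)
    (p : TR2 R) (a : R) : open A -> A p -> (forall q, A q -> f q = g q) ->
  is_derive p ((0, delta_mx 0 i) : TR2 R) g a -> pdy i f p = a.
Proof.
by move=> oA Ap fg ga; rewrite pdyE; have [] := is_derive_on oA Ap fg ga.
Qed.

Lemma sum_ord2 (R : realType) (f : 'I_2 -> R) : \sum_(i < 2) f i = f 0 + f 1.
Proof.
rewrite big_ord_recr big_ord_recr big_ord0 /= add0r.
by congr (f _ + f _); apply/val_inj.
Qed.

(** Serves both D(f) ([a j] a base derivative) and the left side of Euler's relation ([a j] a fibre
    derivative). *)
Lemma is_derive_fibre_sum (R : realType) (a : 'I_2 -> TR2 R -> R)
    (p v : TR2 R) (da : 'I_2 -> R) :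
  (forall j, is_derive p v (a j) (da j)) ->
  is_derive p v (fun q => \sum_(j < 2) q.2 0 j * a j q)
    (\sum_(j < 2) (v.2 0 j * a j p + p.2 0 j * da j)).
Proof.
move=> ada.
have -> : (fun q : TR2 R => \sum_(j < 2) q.2 0 j * a j q) =
    (fun q : TR2 R => q.2 0 0 * a 0 q + q.2 0 1 * a 1 q).
  by apply/funext => q; rewrite sum_ord2.
rewrite sum_ord2.
by apply: is_deriveD; apply: is_derive_mul => //; exact: is_derive_fibre.
Qed.

(** * Euler's relation and the operator D *)

(** Differentiate f(x, (1 + s) y) = (1 + s)^r f(x, y) at s = 0. *)
Lemma euler (R : realType) (A : set (TR2 R)) (r : R) (f : TR2 R -> R)
    (p : TR2 R) : homogeneous A r f -> A p -> differentiable f p ->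
  \sum_(i < 2) p.2 0 i * pdy i f p = r * f p.
Proof.
move=> hf Ap df.
(* Frechet differentiability makes the derivative linear in the direction. *)
have -> : \sum_(i < 2) p.2 0 i * pdy i f p = 'D_((0, p.2) : TR2 R) f p.
  have -> : ((0, p.2) : TR2 R) =
      \sum_(i < 2) p.2 0 i *: ((0, delta_mx 0 i) : TR2 R).
    rewrite !big_ord_recl big_ord0 addr0 /=; congr pair => /=.
      by rewrite !scaler0 addr0.
    by rewrite {1}(row_sum_delta p.2) !big_ord_recl big_ord0 addr0.
  rewrite deriveE // linear_sum; apply: eq_bigr => i _.
  by rewrite linearZ /= pdyE /dy deriveE.
have /is_derive_line d0 : is_derive (p + 0 *: ((0, p.2) : TR2 R)) (0, p.2) f
    ('D_((0, p.2) : TR2 R) f p).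
  by rewrite scale0r addr0; apply/derivableP; exact: diff_derivable.
have d1 : is_derive (0 : R) 1 (fun s => f (p + s *: ((0, p.2) : TR2 R)))
    (r * f p).
  apply: (@near_eq_is_derive R R R (fun s : R => f p * (1 + s) `^ r)).
    near=> s.
    (* Homogeneity concerns positive factors only, so [s] must be close to 0. *)
    have s1 : 0 < 1 + s.
      rewrite -ltrBlDl sub0r; near: s; apply: lt_nbhsr; exact: ltrN10.
    have -> : p + s *: ((0, p.2) : TR2 R) = (p.1, (1 + s) *: p.2).
      by rewrite scalerDl scale1r; case: (p) => a b /=; congr pair; rewrite /= scaler0 addr0.
    by rewrite hf // mulrC.
  have d2 : is_derive (0 : R) 1 ((@powR R ^~ r) \o (fun s : R => 1 + s)) r.
    have e1 : is_derive (0 : R) 1 (fun s : R => 1 + s) 1.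
      by rewrite -[X in is_derive _ _ _ X]add0r; apply: is_deriveD.
    have e2 : is_derive (1 + 0 : R) 1 (@powR R ^~ r) r.
      have := @is_derive1_powR R r 1 ltr01.
      by rewrite powR1 mulr1 addr0.
    by rewrite -[X in is_derive _ _ _ X]mulr1; apply: is_derive1_comp.
  by rewrite mulrC; exact: is_deriveZ.
by case: d0 => _ <-; case: d1.
Unshelve. all: by end_near. Qed.

Lemma pdy_fibre_sum (R : realType) (A : set (TR2 R)) (a : 'I_2 -> TR2 R -> R)
    (p : TR2 R) (i : 'I_2) : (forall j, smooth_on A (a j)) -> A p ->
  pdy i (fun q => \sum_(j < 2) q.2 0 j * a j q) p =
  a i p + \sum_(j < 2) p.2 0 j * pdy i (a j) p.
Proof.
move=> sa Ap.
have /= [_] := is_derive_fibre_sum (fun j => is_derive_pdy i (sa j) Ap).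
rewrite {1}pdyE /dy => ->; rewrite big_split /=; congr (_ + _).
rewrite (bigD1 i) //= !mxE !eqxx mul1r big1 ?addr0 // => j ji.
by rewrite mxE (negbTE ji) andbF mul0r.
Qed.

Lemma pdx_fibre_sum (R : realType) (A : set (TR2 R)) (a : 'I_2 -> TR2 R -> R)
    (p : TR2 R) (i : 'I_2) : (forall j, smooth_on A (a j)) -> A p ->
  pdx i (fun q => \sum_(j < 2) q.2 0 j * a j q) p =
  \sum_(j < 2) p.2 0 j * pdx i (a j) p.
Proof.
move=> sa Ap.
have /= [_] := is_derive_fibre_sum (fun j => is_derive_pdx i (sa j) Ap).
rewrite {1}pdxE /dx => ->.
by apply: eq_bigr => j _; rewrite mxE mul0r add0r.
Qed.

(* The operator D = y^j d/dx^j. *)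
Definition ydx (R : realType) (f : TR2 R -> R) (p : TR2 R) : R :=
  \sum_(j < 2) p.2 0 j * pdx j f p.

(** The term [pdx i f p] comes from differentiating the coefficient y^i of D; the rest is symmetry
    of second derivatives. *)
Lemma pdy_ydx (R : realType) (A : set (TR2 R)) (f : TR2 R -> R) (i : 'I_2)
    (p : TR2 R) : open A -> smooth_on A f -> A p ->
  pdy i (ydx f) p = pdx i f p + ydx (pdy i f) p.
Proof.
move=> oA sf Ap.
have E : \sum_(j < 2) p.2 0 j * pdy i (pdx j f) p = ydx (pdy i f) p.
  by apply: eq_bigr => j _; rewrite (pdy_pdxC i j oA sf Ap).
by rewrite -E; exact: pdy_fibre_sum i (fun j => smooth_pdx j sf) Ap.
Qed.

(** * The metric tensor and homogeneity *)

Lemma is_derive_sqr (R : realType) (V : normedModType R) (f : V -> R)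
    (p v : V) (a : R) : is_derive p v f a ->
  is_derive p v (fun q => f q ^+ 2) (2 * f p * a).
Proof.
move=> fa; have -> : (fun q => f q ^+ 2) = (fun q => f q * f q).
  by apply/funext => q; rewrite expr2.
have -> : 2 * f p * a = a * f p + f p * a by ring.
exact: is_derive_mul.
Qed.

Lemma pdx_sqr (R : realType) (A : set (TR2 R)) (f : TR2 R -> R) (i : 'I_2)
    (p : TR2 R) : open A -> smooth_on A f -> A p ->
  pdx i (fun q => f q ^+ 2) p = 2 * f p * pdx i f p.
Proof.
move=> oA sf Ap; apply: (pdx_on oA Ap) => //.
by apply: is_derive_sqr; exact: is_derive_pdx sf Ap.
Qed.

Lemma pdy_sqr (R : realType) (A : set (TR2 R)) (f : TR2 R -> R) (i : 'I_2)
    (p : TR2 R) : open A -> smooth_on A f -> A p ->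
  pdy i (fun q => f q ^+ 2) p = 2 * f p * pdy i f p.
Proof.
move=> oA sf Ap; apply: (pdy_on oA Ap) => //.
by apply: is_derive_sqr; exact: is_derive_pdy sf Ap.
Qed.

(** Covers the second derivatives of F^2 in the metric and in the spray: there [h] is a fibre or
    base derivative of F^2, known on [A] only as 2 F g. *)
Lemma pdy_half_sqr (R : realType) (A : set (TR2 R)) (f g h : TR2 R -> R)
    (i : 'I_2) (p : TR2 R) : open A -> smooth_on A f -> smooth_on A g -> A p ->
  (forall q, A q -> h q = 2 * f q * g q) ->
  pdy i h p = 2 * (pdy i f p * g p + f p * pdy i g p).
Proof.
move=> oA sf sg Ap hE.
apply: (pdy_on oA Ap (g := fun q => 2 * (f q * g q))).
  by move=> q Aq; rewrite hE // mulrA.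
by apply: is_deriveZ; apply: is_derive_mul; apply: is_derive_pdy Ap.
Qed.

Lemma metricE (R : realType) (A : set (TR2 R)) (F : TR2 R -> R) (i j : 'I_2)
    (p : TR2 R) : open A -> smooth_on A F -> A p ->
  metric F p i j = pdy i F p * pdy j F p + F p * pdy i (pdy j F) p.
Proof.
move=> oA sF Ap; rewrite mxE -!pdyE.
rewrite (pdy_half_sqr i oA sF (smooth_pdy j sF) Ap) ?mulKf //.
by move=> q Aq; exact: pdy_sqr oA sF Aq.
Qed.

Lemma metric_mxC (R : realType) (A : set (TR2 R)) (F : TR2 R -> R)
    (i j : 'I_2) (p : TR2 R) : open A -> smooth_on A F -> A p ->
  metric F p i j = metric F p j i.
Proof.
move=> oA sF Ap; rewrite !(metricE _ _ oA sF Ap) (pdy_pdyC i j oA sF Ap).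
by rewrite [pdy i F p * _]mulrC.
Qed.

(** Euler's relation differentiated with respect to y^i. *)
Lemma euler_pdy (R : realType) (A : set (TR2 R)) (r : R) (f : TR2 R -> R)
    (i : 'I_2) (p : TR2 R) :
  open A -> smooth_on A f -> homogeneous A r f -> A p ->
  pdy i f p + \sum_(j < 2) p.2 0 j * pdy i (pdy j f) p = r * pdy i f p.
Proof.
move=> oA sf hf Ap.
rewrite -(pdy_fibre_sum i (fun j => smooth_pdy j sf) Ap).
apply: (pdy_on oA Ap (g := fun q => r * f q)).
  by move=> q Aq; exact: euler hf Aq (sf [::] q Aq).
by apply: is_deriveZ; exact: is_derive_pdy sf Ap.
Qed.

(** Euler's relation differentiated with respect to x^j and contracted with y^j. *)
Lemma euler_ydx (R : realType) (A : set (TR2 R)) (r : R) (f : TR2 R -> R)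
    (p : TR2 R) :
  open A -> smooth_on A f -> homogeneous A r f -> A p ->
  \sum_(i < 2) p.2 0 i * ydx (pdy i f) p = r * ydx f p.
Proof.
move=> oA sf hf Ap.
have E j : \sum_(i < 2) p.2 0 i * pdx j (pdy i f) p = r * pdx j f p.
  rewrite -(pdx_fibre_sum j (fun i => smooth_pdy i sf) Ap).
  apply: (pdx_on oA Ap (g := fun q => r * f q)).
    by move=> q Aq; exact: euler hf Aq (sf [::] q Aq).
  by apply: is_deriveZ; exact: is_derive_pdx sf Ap.
have := E 0; rewrite sum_ord2 => E0.
have := E 1; rewrite sum_ord2 => E1.
rewrite /ydx !sum_ord2.
transitivity (p.2 0 0 * (r * pdx 0 f p) + p.2 0 1 * (r * pdx 1 f p)); last by ring.
by rewrite -E0 -E1; ring.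
Qed.

(** The fibre Hessian of F annihilates y, and l_j y^j = F. *)
Lemma metric_fibre (R : realType) (A : set (TR2 R)) (F : TR2 R -> R)
    (i : 'I_2) (p : TR2 R) :
  open A -> smooth_on A F -> homogeneous A 1 F -> A p ->
  \sum_(j < 2) metric F p i j * p.2 0 j = F p * pdy i F p.
Proof.
move=> oA sF hF Ap.
have := euler_pdy i oA sF hF Ap; have := euler hF Ap (sF [::] p Ap).
rewrite !mul1r !sum_ord2 !(metricE _ _ oA sF Ap) => <- /eqP.
rewrite -subr_eq0 addrAC subrr add0r => /eqP E.
rewrite -[RHS]addr0 -[X in _ = _ + X](mulr0 (F p)) -E.
have := euler hF Ap (sF [::] p Ap); rewrite mul1r sum_ord2 => <-; ring.
Qed.

(** Raising the index of l_j gives a multiple of y, which makes the spray of a flat metric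
    proportional to y. *)
Lemma mul_invmx_fibre (R : realType) (A : set (TR2 R)) (F : TR2 R -> R)
    (i : 'I_2) (p : TR2 R) :
  open A -> conic_pseudo_finsler A F -> A p ->
  F p * \sum_(j < 2) invmx (metric F p) i j * pdy j F p = p.2 0 i.
Proof.
move=> oA [sF hF uF] Ap.
have E : p.2^T = invmx (metric F p) *m (metric F p *m p.2^T).
  by rewrite mulKmx ?uF.
have -> : p.2 0 i = p.2^T i 0 by rewrite mxE.
rewrite E mxE big_distrr; apply: eq_bigr => j _ /=.
rewrite mulrCA; congr (_ * _); rewrite mxE -(metric_fibre j oA sF hF Ap).
by apply: eq_bigr => k _; rewrite [p.2^T k 0]mxE.
Qed.

Lemma mul_metric_m_up (R : realType) (F : TR2 R -> R) (i : 'I_2) (p : TR2 R) :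
  metric F p \in unitmx -> \sum_(j < 2) metric F p i j * m_up F j p = m_dn F i p.
Proof.
move=> uF; pose m := \col_j m_dn F j p.
have -> : m_dn F i p = (metric F p *m (invmx (metric F p) *m m)) i 0.
  by rewrite mulKVmx // mxE.
rewrite mxE; apply: eq_bigr => j _; congr (_ * _).
by rewrite mxE; apply: eq_bigr => k _; rewrite mxE.
Qed.

Lemma projectively_flatE (R : realType) (A : set (TR2 R)) (F : TR2 R -> R) :
  projectively_flat A F <->
  forall p, A p -> forall i, ydx (pdy i F) p = pdx i F p.
Proof.
split=> H p Ap i; have := H p Ap i; rewrite /ydx pdyE pdxE => <-;
  by apply: eq_bigr => j _; rewrite pdxE.
Qed.

Lemma is_derive_ydx (R : realType) (A : set (TR2 R)) (f : TR2 R -> R)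
    (i : 'I_2) (p : TR2 R) : smooth_on A f -> A p ->
  is_derive p ((0, delta_mx 0 i) : TR2 R) (ydx f) (pdy i (ydx f) p).
Proof.
move=> sf Ap.
have H := is_derive_fibre_sum (fun j => is_derive_pdy i (smooth_pdx j sf) Ap).
by rewrite pdyE; apply/derivableP; exact: (@ex_derive _ _ _ _ _ _ _ H).
Qed.

(** * Spray and horizontal derivatives of a flat metric *)

Lemma spray_flat (R : realType) (A : set (TR2 R)) (F : TR2 R -> R) (i : 'I_2)
    (p : TR2 R) : open A -> conic_pseudo_finsler A F ->
  (forall p, A p -> F p != 0) -> projectively_flat A F -> A p ->
  spray F i p = ydx F p / (2 * F p) * p.2 0 i.
Proof.
move=> oA finF F0 /projectively_flatE flF Ap; have [sF hF uF] := finF.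
(* The sum is 2 l_j D(F) + 2 F D(l_j); by flatness its second term cancels the base derivative 2 F
   d_j F. *)
have E j : \sum_(k < 2) p.2 0 k * dy j (dx k (fun q => F q ^+ 2)) p
     - dx j (fun q => F q ^+ 2) p = 2 * ydx F p * pdy j F p.
  rewrite -[dx j _]pdxE (pdx_sqr j oA sF Ap) -(flF p Ap j).
  have E k : p.2 0 k * dy j (dx k (fun q => F q ^+ 2)) p =
     2 * pdy j F p * (p.2 0 k * pdx k F p) +
     2 * F p * (p.2 0 k * pdx k (pdy j F) p).
    rewrite -[dx k _]pdxE -pdyE.
    rewrite (pdy_half_sqr j oA sF (smooth_pdx k sF) Ap
      (fun q Aq => pdx_sqr k oA sF Aq)).
    by rewrite (pdy_pdxC j k oA sF Ap); ring.
  rewrite (eq_bigr _ (fun k _ => E k)) big_split /= -!big_distrr /=.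
  by rewrite -/(ydx F p) -/(ydx (pdy j F) p) addrK; ring.
rewrite /spray (eq_bigr (fun j => 2 * ydx F p * (invmx (metric F p) i j * pdy j F p))).
  rewrite -big_distrr /= -(mul_invmx_fibre i oA finF Ap).
  by have := F0 p Ap => Fp0; field.
by move=> j _; rewrite E mulrCA.
Qed.

(** From G^j = P y^j, the coefficient G^j_i is (dP/dy^i) y^j plus P times the Kronecker delta;
    Euler's relation in degree 0 kills the first term. *)
Lemma delta_flat (R : realType) (A : set (TR2 R)) (F f : TR2 R -> R) (i : 'I_2)
    (p : TR2 R) : open A -> conic_pseudo_finsler A F ->
  (forall p, A p -> F p != 0) -> projectively_flat A F ->
  smooth_on A f -> homogeneous A 0 f -> A p ->
  delta F i f p = pdx i f p - ydx F p / (2 * F p) * pdy i f p.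
Proof.
move=> oA finF F0 flF sf hf Ap; have [sF _ _] := finF.
have Fp0 : 2 * F p != 0 by rewrite mulf_neq0 ?F0 ?pnatr_eq0.
have dF : is_derive p ((0, delta_mx 0 i) : TR2 R) (fun q => 2 * F q)
    (2 * pdy i F p).
  by apply: is_deriveZ; exact: is_derive_pdy sF Ap.
(* Only the existence of [a], the derivative of P, matters, since its coefficient y^j f_j
   vanishes. *)
have [a Pa] : exists a, is_derive p ((0, delta_mx 0 i) : TR2 R)
    (fun q => ydx F q * (2 * F q)^-1) a.
  have dV := @is_derive_inv _ _ (fun q => 2 * F q) _ _ _ Fp0 dF.
  eexists; exact: is_derive_mul (is_derive_ydx i sF Ap) dV.
have E j : pdy i (spray F j) p =
    a * p.2 0 j + ydx F p / (2 * F p) * (i == j)%:R.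
  apply: (pdy_on oA Ap (g := fun q => ydx F q / (2 * F q) * q.2 0 j)).
    by move=> q Aq; exact: spray_flat oA finF F0 flF Aq.
  have := is_derive_mul Pa (is_derive_fibre p (0, delta_mx 0 i) j).
  by rewrite mxE eqxx eq_sym.
have := euler hf Ap (sf [::] p Ap); rewrite mul0r sum_ord2 => ef.
rewrite /delta -pdxE sum_ord2 -!pdyE !E; congr (_ - _).
have -> : (a * p.2 0 0 + ydx F p / (2 * F p) * (i == 0)%:R) * pdy 0 f p +
   (a * p.2 0 1 + ydx F p / (2 * F p) * (i == 1)%:R) * pdy 1 f p =
   a * (p.2 0 0 * pdy 0 f p + p.2 0 1 * pdy 1 f p) +
   ydx F p / (2 * F p) * ((i == 0)%:R * pdy 0 f p + (i == 1)%:R * pdy 1 f p).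
  by ring.
rewrite ef mulr0 add0r; congr (_ * _).
case: i {dF Pa E} => -[|[|//]] ilt /=.
  rewrite mul1r mul0r addr0; congr (pdy _ f p); exact: val_inj.
rewrite mul1r mul0r add0r; congr (pdy _ f p); exact: val_inj.
Qed.

Lemma hor1_flat (R : realType) (A : set (TR2 R)) (F f : TR2 R -> R)
    (p : TR2 R) : open A -> conic_pseudo_finsler A F ->
  (forall p, A p -> F p != 0) -> projectively_flat A F ->
  smooth_on A f -> homogeneous A 0 f -> A p ->
  hor1 F f p = ydx f p / F p.
Proof.
move=> oA finF F0 flF sf hf Ap.
have := euler hf Ap (sf [::] p Ap); rewrite mul0r sum_ord2 => ef.
rewrite /hor1 sum_ord2 !(delta_flat _ oA finF F0 flF sf hf Ap) /ell_up /ydx.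
rewrite !sum_ord2; set P := (_ / (2 * F p)).
transitivity ((p.2 0 0 * pdx 0 f p + p.2 0 1 * pdx 1 f p
  - P * (p.2 0 0 * pdy 0 f p + p.2 0 1 * pdy 1 f p)) / F p); first by ring.
by rewrite ef mulr0 subr0.
Qed.

Lemma pdy_hor1_flat (R : realType) (A : set (TR2 R)) (F f : TR2 R -> R)
    (i : 'I_2) (p : TR2 R) : open A -> conic_pseudo_finsler A F ->
  (forall p, A p -> F p != 0) -> projectively_flat A F ->
  smooth_on A f -> homogeneous A 0 f -> A p ->
  pdy i (hor1 F f) p = (pdx i f p + ydx (pdy i f) p) / F p
    - ydx f p * pdy i F p / F p ^+ 2.
Proof.
move=> oA finF F0 flF sf hf Ap; have [sF _ _] := finF.
apply: (pdy_on oA Ap (g := fun q => ydx f q * (F q)^-1)).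
  by move=> q Aq; exact: hor1_flat oA finF F0 flF sf hf Aq.
have := is_derive_mul (is_derive_ydx i sf Ap)
  (is_derive_inv (F0 p Ap) (is_derive_pdy i sF Ap)).
by rewrite (pdy_ydx i oA sf Ap) mulNr mulrN mulrA.
Qed.

(** * The conformal change *)

Lemma ydx_conformal (R : realType) (A : set (TR2 R)) (F f : TR2 R -> R)
    (i : 'I_2) (p : TR2 R) : open A -> smooth_on A F -> smooth_on A f -> A p ->
  let Fb := fun q => expR (f q) * F q in
  ydx (pdy i Fb) p - pdx i Fb p = expR (f p) *
    (ydx f p * (pdy i f p * F p + pdy i F p) + ydx (pdy i f) p * F p
     + pdy i f p * ydx F p + ydx (pdy i F) p - pdx i f p * F p - pdx i F p).
Proof.
move=> oA sF sf Ap Fb.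
have dyFb q : A q -> pdy i Fb q = expR (f q) * (pdy i f q * F q + pdy i F q).
  move=> Aq; apply: (pdy_on oA Aq (g := Fb)) => //.
  have := is_derive_mul (is_derive_expR_comp (is_derive_pdy i sf Aq))
    (is_derive_pdy i sF Aq).
  by rewrite mulrDr mulrA.
have dxFb : pdx i Fb p = expR (f p) * (pdx i f p * F p + pdx i F p).
  apply: (pdx_on oA Ap (g := Fb)) => //.
  have := is_derive_mul (is_derive_expR_comp (is_derive_pdx i sf Ap))
    (is_derive_pdx i sF Ap).
  by rewrite mulrDr mulrA.
have dxdyFb j : pdx j (pdy i Fb) p = expR (f p) *
    (pdx j f p * (pdy i f p * F p + pdy i F p) + pdx j (pdy i f) p * F p
     + pdy i f p * pdx j F p + pdx j (pdy i F) p).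
  apply: (pdx_on oA Ap dyFb).
  have d1 := is_derive_mul (is_derive_pdx j (smooth_pdy i sf) Ap)
    (is_derive_pdx j sF Ap).
  have d2 : is_derive p ((delta_mx 0 j, 0) : TR2 R)
      (fun q => pdy i f q * F q + pdy i F q) _ :=
    is_deriveD d1 (is_derive_pdx j (smooth_pdy i sF) Ap).
  have := is_derive_mul (is_derive_expR_comp (is_derive_pdx j sf Ap)) d2.
  by congr is_derive; ring.
rewrite dxFb {1}/ydx sum_ord2 !dxdyFb /ydx !sum_ord2; ring.
Qed.

(** * The Berwald frame *)

Lemma mul_metric_m (R : realType) (F : TR2 R -> R) (p : TR2 R) :
  metric F p \in unitmx -> exists2 s : R, s != 0 &
  metric F p 0 0 * m_up F 0 p + metric F p 0 1 * m_up F 1 p =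
    - s * (p.2 0 1 / F p) /\
  metric F p 1 0 * m_up F 0 p + metric F p 1 1 * m_up F 1 p =
    s * (p.2 0 0 / F p).
Proof.
(* The radicand is the absolute value of the determinant, hence positive. *)
move=> uF; exists (Num.sqrt (signature F p * \det (metric F p))).
  have d0 : \det (metric F p) != 0 by rewrite -unitfE.
  by rewrite /signature -normrEsg sqrtr_eq0 -ltNge normr_gt0.
by rewrite -!(sum_ord2 (fun j => metric F p _ j * m_up F j p))
  !mul_metric_m_up.
Qed.

(** First, F l_i m^i = g_ij y^j m^i = y^j m_j = 0. Second, det(g) times the determinant of (y, m) is
    the determinant of (g y, g m), which equals s F. *)
Lemma berwald_frame (R : realType) (A : set (TR2 R)) (F : TR2 R -> R)
    (p : TR2 R) : open A -> conic_pseudo_finsler A F ->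
  (forall p, A p -> F p != 0) -> A p ->
  pdy 0 F p * m_up F 0 p + pdy 1 F p * m_up F 1 p = 0 /\
  p.2 0 0 * m_up F 1 p - p.2 0 1 * m_up F 0 p != 0.
Proof.
move=> oA [sF hF uF] F0 Ap; have Fp0 := F0 p Ap.
have [s s0 [m0E m1E]] := mul_metric_m (uF p Ap).
have := metric_fibre 0 oA sF hF Ap; have := metric_fibre 1 oA sF hF Ap.
have := euler hF Ap (sF [::] p Ap); rewrite !sum_ord2 mul1r => lE y1E y0E.
have gC := metric_mxC 1 0 oA sF Ap; rewrite gC in m1E y1E.
split.
  apply: (mulfI Fp0); rewrite mulr0 mulrDr !mulrA -y0E -y1E.
  transitivity (p.2 0 0 * (metric F p 0 0 * m_up F 0 p + metric F p 0 1 * m_up F 1 p)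
    + p.2 0 1 * (metric F p 0 1 * m_up F 0 p + metric F p 1 1 * m_up F 1 p)).
    by ring.
  by rewrite m0E m1E; ring.
have dE : (metric F p 0 0 * metric F p 1 1 - metric F p 0 1 ^+ 2) *
    (p.2 0 0 * m_up F 1 p - p.2 0 1 * m_up F 0 p) = s * F p.
  transitivity ((metric F p 0 0 * p.2 0 0 + metric F p 0 1 * p.2 0 1) *
      (metric F p 0 1 * m_up F 0 p + metric F p 1 1 * m_up F 1 p)
    - (metric F p 0 1 * p.2 0 0 + metric F p 1 1 * p.2 0 1) *
      (metric F p 0 0 * m_up F 0 p + metric F p 0 1 * m_up F 1 p)).
    by ring.
  by rewrite m0E m1E y0E y1E -[in RHS]lE; field.
apply/eqP => d0; move/eqP: dE; rewrite d0 mulr0 eq_sym.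
by rewrite mulf_eq0 (negbTE s0) (negbTE Fp0).
Qed.

(** * The flatness defect and its components along y and m *)

(** Cramer's rule: a covector vanishing on two independent vectors is zero. *)
Lemma cross_eq0 (R : fieldType) (y0 y1 m0 m1 w0 w1 : R) :
  y0 * m1 - y1 * m0 != 0 -> y0 * w0 + y1 * w1 = 0 ->
  m0 * w0 + m1 * w1 = 0 -> w0 = 0 /\ w1 = 0.
Proof.
move=> d0 yw mw; split; apply: (mulfI d0); rewrite mulr0.
  transitivity (m1 * (y0 * w0 + y1 * w1) - y1 * (m0 * w0 + m1 * w1)); first by ring.
  by rewrite yw mw !mulr0 subr0.
transitivity (y0 * (m0 * w0 + m1 * w1) - m0 * (y0 * w0 + y1 * w1)); first by ring.
by rewrite yw mw !mulr0 subr0.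
Qed.

(* [expR phi] times this is the defect of [expR phi * F] from being projectively
   flat when [F] is. *)
Definition flat_defect (R : realType) (F phi : TR2 R -> R) (i : 'I_2)
    (p : TR2 R) : R :=
  ydx phi p * (pdy i phi p * F p + pdy i F p) + ydx (pdy i phi) p * F p
  + pdy i phi p * ydx F p - pdx i phi p * F p.

Lemma flat_defectP (R : realType) (A : set (TR2 R)) (F phi : TR2 R -> R) :
  open A -> smooth_on A F -> smooth_on A phi -> projectively_flat A F ->
  projectively_flat A (fun p => expR (phi p) * F p) <->
  forall p, A p -> forall i, flat_defect F phi i p = 0.
Proof.
move=> oA sF sphi /projectively_flatE flF.
have E p i : A p -> ydx (pdy i (fun p => expR (phi p) * F p)) p -
    pdx i (fun p => expR (phi p) * F p) p = expR (phi p) * flat_defect F phi i p.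
  move=> Ap; rewrite (ydx_conformal i oA sF sphi Ap) (flF p Ap i).
  by rewrite /flat_defect; ring.
split=> [/projectively_flatE|] H.
  move=> p Ap i; have := E p i Ap; rewrite H // subrr => /esym/eqP.
  by rewrite mulf_eq0 gt_eqF ?expR_gt0 //= => /eqP.
apply/projectively_flatE => p Ap i.
by apply/eqP; rewrite -subr_eq0 E // H // mulr0.
Qed.

(** Euler's relations give y^i phi_i = 0, y^i D(phi_i) = 0 and y^i l_i = F; what remains is D(phi) F
    - D(phi) F. *)
Lemma fibre_flat_defect (R : realType) (A : set (TR2 R)) (F phi : TR2 R -> R)
    (p : TR2 R) : open A -> smooth_on A F -> homogeneous A 1 F ->
  smooth_on A phi -> homogeneous A 0 phi -> A p ->
  p.2 0 0 * flat_defect F phi 0 p + p.2 0 1 * flat_defect F phi 1 p = 0.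
Proof.
move=> oA sF hF sphi hphi Ap.
have := euler hF Ap (sF [::] p Ap); have := euler hphi Ap (sphi [::] p Ap).
have := euler_ydx oA sphi hphi Ap.
rewrite !sum_ord2 !mul0r mul1r => cE aE lE.
have bE : p.2 0 0 * pdx 0 phi p + p.2 0 1 * pdx 1 phi p = ydx phi p.
  by rewrite /ydx sum_ord2.
transitivity ((p.2 0 0 * pdy 0 phi p + p.2 0 1 * pdy 1 phi p)
      * (ydx phi p * F p + ydx F p)
  + ydx phi p * (p.2 0 0 * pdy 0 F p + p.2 0 1 * pdy 1 F p)
  + (p.2 0 0 * ydx (pdy 0 phi) p + p.2 0 1 * ydx (pdy 1 phi) p) * F p
  - (p.2 0 0 * pdx 0 phi p + p.2 0 1 * pdx 1 phi p) * F p).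
  by rewrite /flat_defect; ring.
by rewrite aE lE cE bE; ring.
Qed.

Lemma m_flat_defect (R : realType) (A : set (TR2 R)) (F phi : TR2 R -> R)
    (p : TR2 R) : open A -> conic_pseudo_finsler A F ->
  (forall p, A p -> F p != 0) -> projectively_flat A F ->
  smooth_on A phi -> homogeneous A 0 phi -> A p ->
  F p * (vert2 F phi p * hor1 F phi p + vert2 F (hor1 F phi) p
         - 2 * hor2 F phi p) =
  signature F p * (m_up F 0 p * flat_defect F phi 0 p
                   + m_up F 1 p * flat_defect F phi 1 p).
Proof.
move=> oA finF F0 flF sphi hphi Ap; have Fp0 := F0 p Ap.
have [lm _] := berwald_frame oA finF F0 Ap.
rewrite {2}/vert2 (hor1_flat oA finF F0 flF sphi hphi Ap).
rewrite /vert2 /hor2 !sum_ord2 -!pdyE.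
rewrite !(pdy_hor1_flat _ oA finF F0 flF sphi hphi Ap).
rewrite !(delta_flat _ oA finF F0 flF sphi hphi Ap).
(* The quotient rule for D(phi) / F yields - D(phi) l_i where the defect has + D(phi) l_i; the
   discrepancy is a multiple of l_i m^i = 0. *)
transitivity (signature F p * (m_up F 0 p * flat_defect F phi 0 p
    + m_up F 1 p * flat_defect F phi 1 p)
  - 2 * signature F p * ydx phi p *
    (pdy 0 F p * m_up F 0 p + pdy 1 F p * m_up F 1 p)).
  by rewrite /flat_defect; field.
by rewrite lm mulr0 subr0.
Qed.

Theorem theorem4p7 (R : realType) (U : set 'rV[R]_2) (A : set (TR2 R))
    (F I phi : TR2 R -> R)
    (openU : open U)
    (conicA : conic_subbundle U A)
    (finslerF : conic_pseudo_finsler A F)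
    (F_neq0 : forall p, A p -> F p != 0)
    (mainI : is_main_scalar A F I)
    (flatF : projectively_flat A F)
    (smooth_phi : smooth_on A phi)
    (hom_phi : homogeneous A 0 phi)
    (nondeg : forall p, A p ->
       sigma F I phi p + signature F p - vert2 F phi p ^+ 2 != 0) :
  projectively_flat A (fun p => expR (phi p) * F p) <->
  (forall p, A p ->
     vert2 F phi p * hor1 F phi p + vert2 F (hor1 F phi) p
     - 2 * hor2 F phi p = 0).
Proof.
have [oA _ _ _ _] := conicA; have [sF hF uF] := finslerF.
rewrite flat_defectP //.
have mE p (Ap : A p) := m_flat_defect oA finslerF F_neq0 flatF smooth_phi hom_phi Ap.
split=> H p Ap.
  by apply: (mulfI (F_neq0 p Ap)); rewrite mE // !H // !mulr0 addr0 mulr0.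
have [_ d0] := berwald_frame oA finslerF F_neq0 Ap.
have yW := fibre_flat_defect oA sF hF smooth_phi hom_phi Ap.
have sg0 : signature F p != 0 by rewrite sgr_eq0 -unitfE; exact: uF.
(* The y-component of the defect always vanishes; the condition, once the nonzero signature is
   cancelled, kills the m-component. *)
have [] := cross_eq0 d0 yW.
  by apply: (mulfI sg0); rewrite -mE // H // !mulr0.
move=> W0 W1; case=> -[|[|//]] ilt.
  by rewrite -[RHS]W0; congr flat_defect; exact: val_inj.
by rewrite -[RHS]W1; congr flat_defect; exact: val_inj.
Qed.
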